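(* Let $R$ be an integral domain with fraction field $K$ and let $A$ be an $R$-algebra that is finitely presented and flat as an $R$-module. Let $\{c_i\}_{i\in I}$ be the block idempotents of $A^K=K\otimes_R A$, and let $\mathrm{Bl}_A:\operatorname{Spec}(R)\to\mathrm{Part}(I)$ be the map sending $\mathfrak{p}$ to the partition of $I$ given by the blocks of $A_{\mathfrak{p}}$. For every partition $\mathscr{P}$ of $I$: (1) the set $\mathrm{Bl}_A^{-1}(\leq\mathscr{P})=\{\mathfrak{p}\in\operatorname{Spec}(R)\mid \mathrm{Bl}_A(\mathfrak{p})\leq\mathscr{P}\}$ is closed in $\operatorname{Spec}(R)$; (2) the set $\mathrm{Bl}_A^{-1}(\mathscr{P})=\{\mathfrak{p}\mid \mathrm{Bl}_A(\mathfrak{p})=\mathscr{P}\}$ is open in $\mathrm{Bl}_A^{-1}(\leq\mathscr{P})$, hence locally closed in $\operatorname{Spec}(R)$; (3) $\overline{\mathrm{Bl}_A^{-1}(\mathscr{P})}\subseteq\mathrm{Bl}_A^{-1}(\leq\mathscr{P})$. In particular, the finite decomposition $\operatorname{Spec}(R)=\coprod_{\mathscr{P}}\mathrm{Bl}_A^{-1}(\mathscr{P})$ is a stratification of $\operatorname{Spec}(R)$.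
   Context: Block idempotents of a ring are its centrally-primitive idempotents (primitive idempotents of the center). For $\mathfrak{p}\in\operatorname{Spec}(R)$ the canonical map $A_{\mathfrak{p}}\to A^K$ is injective, and $A_{\mathfrak p}$ has finitely many block idempotents, which are pairwise orthogonal with sum $1$. Each block idempotent of $A_{\mathfrak{p}}$ is, in $A^K$, a sum $\sum_{i\in I'}c_i$ for a unique subset $I'\subseteq I$; the subsets $I'$ obtained from all block idempotents of $A_{\mathfrak{p}}$ form a partition of $I$, denoted $\mathrm{Bl}_A(\mathfrak{p})$. Here $\mathrm{Part}(I)$ is the set of partitions of $I$, ordered by $\mathscr{P}'\leq\mathscr{P}$ iff $\mathscr{P}'$ is coarser than (or equal to) $\mathscr{P}$, i.e. every member of $\mathscr{P}'$ is a union of members of $\mathscr{P}$. ''Stratification'' means that the strata $\mathrm{Bl}_A^{-1}(\mathscr{P})$ are locally closed and the closure of each stratum is contained in $\mathrm{Bl}_A^{-1}(\leq\mathscr{P})=\coprod_{\mathscr{P}'\leq\mathscr{P}}\mathrm{Bl}_A^{-1}(\mathscr{P}')$. *)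

(* Defs.v *)
From HB Require Import structures.
From mathcomp Require Import all_boot all_order all_algebra.
From mathcomp Require Import mathcomp_extra boolp classical_sets functions.
From mathcomp Require Import cardinality fsbigop topology.
From mathcomp Require Import fraction ring_quotient generic_quotient.

Set Implicit Arguments.
Unset Strict Implicit.
Unset Printing Implicit Defensive.

Import GRing.Theory.
Local Open Scope ring_scope.
Local Open Scope quotient_scope.
Local Open Scope classical_set_scope.

(* The library's algType requires 1 != 0, which would exclude the zero algebra
   and force tensor products to be nonzero; an R-algebra is therefore encoded as
   a possibly trivial ring with a ring morphism from R to its center. *)
Record ralgebra (R : comPzRingType) := RAlgebra {
  ralg_ring : pzRingType;
  ralg_in : {rmorphism R -> ralg_ring};
  ralg_central : forall r x, ralg_in r * x = x * ralg_in r
}.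
Arguments RAlgebra {R ralg_ring ralg_in}.

Definition ralg_sort (R : comPzRingType) (A : ralgebra R) : Type := ralg_ring A.
Coercion ralg_sort : ralgebra >-> Sortclass.

Section RAlgebraModule.
Variables (R : comPzRingType) (A : ralgebra R).

HB.instance Definition _ := GRing.PzRing.copy (ralg_sort A) (ralg_ring A).

Definition ralg_scale (r : R) (x : ralg_sort A) : ralg_sort A :=
  (ralg_in A r : ralg_sort A) * x.

Lemma ralg_scaleA r s x : ralg_scale r (ralg_scale s x) = ralg_scale (r * s) x.
Proof. by rewrite /ralg_scale mulrA -rmorphM. Qed.

Lemma ralg_scale1 : left_id 1 ralg_scale.
Proof. by move=> x; rewrite /ralg_scale rmorph1 mul1r. Qed.

Lemma ralg_scaleDr : right_distributive ralg_scale +%R.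
Proof. by move=> r x y; rewrite /ralg_scale mulrDr. Qed.

Lemma ralg_scaleDl x : {morph ralg_scale^~ x : r s / r + s}.
Proof. by move=> r s; rewrite /ralg_scale rmorphD mulrDl. Qed.

HB.instance Definition _ := GRing.Zmodule_isLmodule.Build R (ralg_sort A)
  ralg_scaleA ralg_scale1 ralg_scaleDr ralg_scaleDl.

Lemma ralg_scaleAl (r : R) (x y : A) : r *: (x * y) = (r *: x) * y.
Proof. exact: mulrA. Qed.

Lemma ralg_scaleAr (r : R) (x y : A) : r *: (x * y) = x * (r *: y).
Proof.
rewrite [LHS]mulrA [X in X * y](_ : _ = x * (ralg_in A r : A)) -?mulrA //.
exact: ralg_central.
Qed.

End RAlgebraModule.

Section Tensor.
Variables (R : comPzRingType) (M N : lmodType R).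

(* A list of pairs stands for the formal sum of its entries. No formal
   negatives are needed, since (m, n) + (- m, n) ~ (0, n) ~ 0. *)
Inductive tensor_rel : seq (M * N) -> seq (M * N) -> Prop :=
| trel_refl s : tensor_rel s s
| trel_sym s t : tensor_rel s t -> tensor_rel t s
| trel_trans s t u : tensor_rel s t -> tensor_rel t u -> tensor_rel s u
| trel_cat s s' t t' :
    tensor_rel s s' -> tensor_rel t t' -> tensor_rel (s ++ t) (s' ++ t')
| trel_comm s t : tensor_rel (s ++ t) (t ++ s)
| trel_0 n : tensor_rel [:: (0, n)] [::]
| trel_Dl m m' n : tensor_rel [:: (m + m', n)] [:: (m, n); (m', n)]
| trel_Dr m n n' : tensor_rel [:: (m, n + n')] [:: (m, n); (m, n')]
| trel_Z r m n : tensor_rel [:: (r *: m, n)] [:: (m, r *: n)].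

Definition tensor_relb (s t : seq (M * N)) := `[< tensor_rel s t >].

Lemma tensor_relb_equiv : equiv_class_of tensor_relb.
Proof.
split=> [s|s t|t s u]; first exact/asboolP/trel_refl.
  by apply/asboolP/asboolP; exact: trel_sym.
by move=> /asboolP st /asboolP tu; apply/asboolP; exact: trel_trans st tu.
Qed.
Canonical tensor_relb_equiv_rel := EquivRelPack tensor_relb_equiv.

Definition tensor := {eq_quot tensor_relb}.

HB.instance Definition _ := Choice.on tensor.
HB.instance Definition _ : EqQuotient _ tensor_relb tensor :=
  EqQuotient.on tensor.

Definition tens_seq (s : seq (M * N)) : tensor := \pi_tensor s.
Definition tens (m : M) (n : N) : tensor := tens_seq [:: (m, n)].
Definition tensor_opp_seq (s : seq (M * N)) := [seq (- x.1, x.2) | x <- s].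
Definition tensor_zero : tensor := tens_seq [::].
Definition tensor_opp (u : tensor) : tensor :=
  tens_seq (tensor_opp_seq (repr u)).
Definition tensor_add (u v : tensor) : tensor := tens_seq (repr u ++ repr v).

Lemma tens_seqP s t : tens_seq s = tens_seq t <-> tensor_rel s t.
Proof. by split=> [/eqmodP/asboolP//|st]; exact/eqmodP/asboolP. Qed.

Lemma repr_tens_seq s : tensor_rel (repr (tens_seq s)) s.
Proof. by apply/tens_seqP; rewrite /tens_seq reprK. Qed.

Lemma tens_seq_repr u : tens_seq (repr u) = u.
Proof. by rewrite /tens_seq reprK. Qed.

Lemma tensor_addE s t :
  tensor_add (tens_seq s) (tens_seq t) = tens_seq (s ++ t).
Proof. by apply/tens_seqP/trel_cat; exact: repr_tens_seq. Qed.

Lemma tensor_opp_rel s t :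
  tensor_rel s t -> tensor_rel (tensor_opp_seq s) (tensor_opp_seq t).
Proof.
elim=> {s t} /=.
- by move=> s; exact: trel_refl.
- by move=> s t _; exact: trel_sym.
- by move=> s t u _ st _; exact: trel_trans.
- move=> s s' t t' _ ss' _ tt'.
  by rewrite /tensor_opp_seq !map_cat; exact: trel_cat.
- by move=> s t; rewrite /tensor_opp_seq !map_cat; exact: trel_comm.
- by move=> n; rewrite oppr0; exact: trel_0.
- by move=> m m' n; rewrite opprD; exact: trel_Dl.
- by move=> m n n'; exact: trel_Dr.
- by move=> r m n; rewrite -scalerN; exact: trel_Z.
Qed.

Lemma tensor_oppE s : tensor_opp (tens_seq s) = tens_seq (tensor_opp_seq s).
Proof. by apply/tens_seqP/tensor_opp_rel; exact: repr_tens_seq. Qed.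

Lemma tensor_addA : associative tensor_add.
Proof.
move=> u v w; rewrite -(tens_seq_repr u) -(tens_seq_repr v) -(tens_seq_repr w).
by rewrite !tensor_addE catA.
Qed.

Lemma tensor_addC : commutative tensor_add.
Proof. by move=> u v; apply/tens_seqP; exact: trel_comm. Qed.

Lemma tensor_add0 : left_id tensor_zero tensor_add.
Proof. by move=> u; rewrite -(tens_seq_repr u) /tensor_zero tensor_addE. Qed.

Lemma tensor_addN : left_inverse tensor_zero tensor_opp tensor_add.
Proof.
move=> u; rewrite -(tens_seq_repr u) tensor_oppE.
elim: (repr u) => [|[m n] s IHs]; first by rewrite tensor_addE.
rewrite [tensor_opp_seq _]/= -[_ :: tensor_opp_seq s]cat1s -[_ :: s]cat1s.
rewrite -!tensor_addE -tensor_addA [tensor_add (tens_seq [:: (m, n)]) _]tensor_addC.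
rewrite [X in tensor_add _ X]tensor_addA IHs tensor_add0 tensor_addE.
apply/tens_seqP; apply: trel_trans (trel_0 n).
by apply: trel_sym; rewrite -(addNr m); exact: trel_Dl.
Qed.

HB.instance Definition _ := GRing.isZmodule.Build tensor
  tensor_addA tensor_addC tensor_add0 tensor_addN.

Lemma tens_seqE s : tens_seq s = \sum_(x <- s) tens x.1 x.2.
Proof.
elim: s => [|[m n] s IHs]; first by rewrite big_nil.
by rewrite big_cons -IHs -[in LHS]cat1s; symmetry; exact: tensor_addE.
Qed.

Lemma tensor_ind (P : tensor -> Prop) :
  P 0 -> (forall u v, P u -> P v -> P (u + v)) -> (forall m n, P (tens m n)) ->
  forall u, P u.
Proof.
move=> P0 PD Pt u; rewrite -(tens_seq_repr u) tens_seqE.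
by apply: big_ind => // x _; exact: Pt.
Qed.

Lemma tensDl m m' n : tens (m + m') n = tens m n + tens m' n.
Proof.
rewrite [RHS](_ : _ = tens_seq [:: (m, n); (m', n)]); last exact: tensor_addE.
exact/tens_seqP/trel_Dl.
Qed.

Lemma tensDr m n n' : tens m (n + n') = tens m n + tens m n'.
Proof.
rewrite [RHS](_ : _ = tens_seq [:: (m, n); (m, n')]); last exact: tensor_addE.
exact/tens_seqP/trel_Dr.
Qed.

Lemma tensZ r m n : tens (r *: m) n = tens m (r *: n).
Proof. exact/tens_seqP/trel_Z. Qed.

Definition balanced (V : zmodType) (f : M -> N -> V) :=
  [/\ forall m m' n, f (m + m') n = f m n + f m' n,
      forall m n n', f m (n + n') = f m n + f m n'
    & forall r m n, f (r *: m) n = f m (r *: n)].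

(* Junk unless f is balanced. *)
Definition tensor_lift (V : zmodType) (f : M -> N -> V) (u : tensor) : V :=
  \sum_(x <- repr u) f x.1 x.2.

Section Lift.
Variables (V : zmodType) (f : M -> N -> V).
Hypothesis bf : balanced f.

Lemma tensor_lift_seq s : tensor_lift f (tens_seq s) = \sum_(x <- s) f x.1 x.2.
Proof.
case: bf => fDl fDr fZ; rewrite /tensor_lift.
move: (repr _) (repr_tens_seq s) => s0; elim=> {s0 s} //=.
- by move=> s t u _ -> _ ->.
- by move=> s s' t t' _ ss' _ tt'; rewrite !big_cat /= ss' tt'.
- by move=> s t; rewrite !big_cat /= addrC.
- move=> n; rewrite big_cons !big_nil addr0.
  by apply: (addrI (f 0 n)); rewrite -fDl !addr0.
- by move=> m m' n; rewrite !big_cons !big_nil !addr0 fDl.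
- by move=> m n n'; rewrite !big_cons !big_nil !addr0 fDr.
- by move=> r m n; rewrite !big_cons !big_nil !addr0 fZ.
Qed.

Lemma tensor_lift_tens m n : tensor_lift f (tens m n) = f m n.
Proof. by rewrite tensor_lift_seq big_cons big_nil addr0. Qed.

Lemma tensor_liftD u v :
  tensor_lift f (u + v) = tensor_lift f u + tensor_lift f v.
Proof.
rewrite -(tens_seq_repr u) -(tens_seq_repr v) [X in tensor_lift f X]tensor_addE.
by rewrite !tensor_lift_seq big_cat.
Qed.

Lemma tensor_lift0 : tensor_lift f 0 = 0.
Proof. by apply: (addrI (tensor_lift f 0)); rewrite -tensor_liftD !addr0. Qed.

End Lift.

End Tensor.

Section TensorMap.
Variables (R : comPzRingType) (M M' N N' : lmodType R).

Definition tensor_map (f : M -> M') (g : N -> N') : tensor M N -> tensor M' N' :=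
  tensor_lift (fun m n => tens (f m) (g n)).

End TensorMap.

Section TensorRing.
Variables (R : comPzRingType) (B A : ralgebra R).
Implicit Types u v w : tensor B A.

Definition tens_mul (b : B) (a : A) : tensor B A -> tensor B A :=
  tensor_lift (fun b' a' => tens (b * b') (a * a')).

Lemma tens_mul_balanced (b : B) (a : A) :
  balanced (fun b' a' => tens (b * b') (a * a')).
Proof.
split=> [x y n|m x y|r m n]; rewrite ?mulrDr ?tensDl ?tensDr //.
by rewrite -!ralg_scaleAr tensZ.
Qed.

Definition tensor_mul (u v : tensor B A) : tensor B A :=
  tensor_lift (fun b a => tens_mul b a v) u.

Definition tensor_one : tensor B A := tens (1 : B) (1 : A).

Lemma tensor_mul_balanced v : balanced (fun b a => tens_mul b a v).
Proof.
pose bal := tens_mul_balanced; rewrite /tens_mul.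
split=> [x y n|m x y|r m n]; elim/tensor_ind: v => [|v w IHv IHw|b a].
all: rewrite ?(tensor_lift0 (bal _ _)) ?addr0 //.
all: rewrite ?(tensor_liftD (bal _ _)) ?IHv ?IHw // 1?addrACA //.
all: rewrite !(tensor_lift_tens (bal _ _)) ?mulrDl ?tensDl ?tensDr //.
by rewrite -!ralg_scaleAl tensZ.
Qed.

Lemma tensor_mul_tens b a b' a' :
  tensor_mul (tens b a) (tens b' a') = tens (b * b') (a * a').
Proof.
rewrite /tensor_mul (tensor_lift_tens (tensor_mul_balanced _)).
by rewrite /tens_mul (tensor_lift_tens (tens_mul_balanced _ _)).
Qed.

Lemma tensor_mulDl : left_distributive tensor_mul +%R.
Proof. by move=> u v w; exact: (tensor_liftD (tensor_mul_balanced w)). Qed.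

Lemma tensor_mul0l v : tensor_mul 0 v = 0.
Proof. exact: (tensor_lift0 (tensor_mul_balanced v)). Qed.

Lemma tensor_mulDr : right_distributive tensor_mul +%R.
Proof.
move=> u v w; elim/tensor_ind: u => [|u u' IHu IHu'|b a].
- by rewrite !tensor_mul0l addr0.
- by rewrite !tensor_mulDl IHu IHu' addrACA.
rewrite /tensor_mul !(tensor_lift_tens (tensor_mul_balanced _)).
exact: (tensor_liftD (tens_mul_balanced _ _)).
Qed.

Lemma tensor_mul0r v : tensor_mul v 0 = 0.
Proof.
by apply: (addrI (tensor_mul v 0)); rewrite -tensor_mulDr !addr0.
Qed.

Lemma tensor_mulA : associative tensor_mul.
Proof.
move=> u v w; elim/tensor_ind: u => [|u u' IHu IHu'|b a].
- by rewrite !tensor_mul0l.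
- by rewrite !tensor_mulDl IHu IHu'.
elim/tensor_ind: v => [|v v' IHv IHv'|b' a'].
- by rewrite !(tensor_mul0l, tensor_mul0r).
- by rewrite !(tensor_mulDl, tensor_mulDr) IHv IHv'.
elim/tensor_ind: w => [|w w' IHw IHw'|b'' a''].
- by rewrite !tensor_mul0r.
- by rewrite !tensor_mulDr IHw IHw'.
by rewrite !tensor_mul_tens !mulrA.
Qed.

Lemma tensor_mul1l : left_id tensor_one tensor_mul.
Proof.
move=> u; elim/tensor_ind: u => [|u u' IHu IHu'|b a].
- by rewrite tensor_mul0r.
- by rewrite tensor_mulDr IHu IHu'.
by rewrite tensor_mul_tens !mul1r.
Qed.

Lemma tensor_mul1r : right_id tensor_one tensor_mul.
Proof.
move=> u; elim/tensor_ind: u => [|u u' IHu IHu'|b a].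
- by rewrite tensor_mul0l.
- by rewrite tensor_mulDl IHu IHu'.
by rewrite tensor_mul_tens !mulr1.
Qed.

HB.instance Definition _ := GRing.Zmodule_isPzRing.Build (tensor B A)
  tensor_mulA tensor_mul1l tensor_mul1r tensor_mulDl tensor_mulDr.

End TensorRing.

Section ModuleProperties.
Variables (R : comPzRingType) (M : lmodType R).

(* M is the cokernel of a matrix R^m -> R^n. *)
Definition finitely_presented : Prop :=
  exists (m n : nat) (G : 'M[R]_(m, n)) (f : {linear 'rV[R]_n -> M}),
    (forall x, exists v, f v = x) /\
    (forall v, f v = 0 <-> exists u, v = u *m G).

Definition flat : Prop :=
  forall (N N' : lmodType R) (f : {linear N -> N'}),
    injective f -> injective (tensor_map f (@idfun M)).

End ModuleProperties.

Section BlockIdempotents.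
Variable A : pzRingType.

Definition center : set A := [set z | forall x, z * x = x * z].

Definition central_idempotent (e : A) : Prop := center e /\ e * e = e.

Definition block_idempotent (e : A) : Prop :=
  [/\ central_idempotent e, e != 0 &
      forall f g, central_idempotent f -> central_idempotent g ->
        f * g = 0 -> e = f + g -> f = 0 \/ g = 0].

End BlockIdempotents.

(* idealr_closed includes 1 \notin spec_ideal. *)
Record spec (R : comNzRingType) := Spec {
  spec_ideal :> {pred R};
  spec_idealP : idealr_closed spec_ideal;
  spec_primeP : prime_idealr_closed spec_ideal
}.

Section Zariski.
Variable R : comNzRingType.

HB.instance Definition _ := gen_eqMixin (spec R).
HB.instance Definition _ := gen_choiceMixin (spec R).

Definition zariski_closed (E : set R) : set (spec R) :=
  [set p | forall x, E x -> x \in spec_ideal p].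

Definition zariski_open (U : set (spec R)) : Prop :=
  exists E : set R, U = ~` zariski_closed E.

Lemma zariski_openT : zariski_open setT.
Proof.
exists [set 1]; apply/seteqP; split=> // p _ /= /(_ _ erefl).
by have [_ /negP] := spec_idealP p.
Qed.

Lemma zariski_openI : setI_closed zariski_open.
Proof.
move=> _ _ [E ->] [F ->].
exists [set z | exists x y, [/\ E x, F y & z = x * y]].
rewrite -setCU; congr (~` _); apply/seteqP; split=> p /=.
  have [p0 _ pD] := spec_idealP p.
  have pM a u : u \in spec_ideal p -> a * u \in spec_ideal p.
    by move=> pu; rewrite -[_ * _]addr0 pD.
  move=> EF _ [x [y [Ex Fy ->]]]; case: EF => [/(_ _ Ex)|/(_ _ Fy)].
    by rewrite mulrC; exact: pM.
  exact: pM.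
move=> EF; apply: contrapT => /not_orP[/existsNP[x /not_implyP[Ex /negP px]]].
move=> /existsNP[y /not_implyP[Fy /negP py]].
have /spec_primeP : x * y \in spec_ideal p by apply: EF; exists x, y.
by rewrite (negPf px) (negPf py).
Qed.

Lemma zariski_open_bigcup (J : Type) (f : J -> set (spec R)) :
  (forall j, zariski_open (f j)) -> zariski_open (\bigcup_j f j).
Proof.
move=> /choice[E fE]; exists (\bigcup_j E j).
rewrite (eq_bigcupr (fun j _ => fE j)) -setC_bigcap; congr (~` _).
apply/seteqP; split=> p /=; first by move=> pE x [j _ Ex]; exact: (pE j I x Ex).
by move=> pE j _ x Ex; apply: pE; exists j.
Qed.

HB.instance Definition _ := isOpenTopological.Build (spec R)
  zariski_openT zariski_openI zariski_open_bigcup.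

End Zariski.

Section Localization.
Variable R : idomainType.

Definition frac_ralgebra : ralgebra R :=
  @RAlgebra R {fraction R} (@FracField.tofrac R) (fun r x => mulrC _ _).

Variable p : spec R.

(* R_p, realized as a subring of the fraction field. *)
Definition loc_pred : {pred {fraction R}} :=
  fun x => `[< exists a s : R, s \notin spec_ideal p /\
               x = FracField.tofrac a / FracField.tofrac s >].

Lemma loc_subring_closed : subring_closed loc_pred.
Proof.
have [p0 p1 _] := spec_idealP p.
have nz (s : R) : s \notin spec_ideal p -> FracField.tofrac s != 0.
  by rewrite tofrac_eq0; apply: contraNneq => ->.
have pM s t : s \notin spec_ideal p -> t \notin spec_ideal p ->
    s * t \notin spec_ideal p.
  by move=> ps pt; apply/negP => /spec_primeP; rewrite (negPf ps) (negPf pt).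
split.
- by apply/asboolP; exists 1, 1; rewrite rmorph1 divr1.
- move=> _ _ /asboolP[a [s [ps ->]]] /asboolP[b [t [pt ->]]]; apply/asboolP.
  exists (a * t - b * s), (s * t); split; first exact: pM.
  by rewrite -mulNr addf_div ?nz// rmorphB !rmorphM mulNr.
- move=> _ _ /asboolP[a [s [ps ->]]] /asboolP[b [t [pt ->]]]; apply/asboolP.
  exists (a * b), (s * t); split; first exact: pM.
  by rewrite mulf_div !rmorphM.
Qed.

HB.instance Definition _ := GRing.isSubringClosed.Build {fraction R} loc_pred
  loc_subring_closed.

Record loc := Loc { loc_val : {fraction R}; _ : loc_val \in loc_pred }.

HB.instance Definition _ := [isSub for loc_val].
HB.instance Definition _ := [Choice of loc by <:].
HB.instance Definition _ := [SubChoice_isSubComNzRing of loc by <:].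

Lemma tofrac_loc (r : R) : FracField.tofrac r \in loc_pred.
Proof.
have [_ p1 _] := spec_idealP p.
by apply/asboolP; exists r, 1; rewrite rmorph1 divr1.
Qed.

Definition toloc (r : R) : loc := Loc (tofrac_loc r).

Lemma toloc_zmod : zmod_morphism toloc.
Proof. by move=> r s; apply: val_inj; rewrite /= !rmorphB. Qed.

Lemma toloc_monoid : monoid_morphism toloc.
Proof.
by split=> [|r s]; apply: val_inj; rewrite /= ?rmorph1 ?rmorphM.
Qed.

HB.instance Definition _ := GRing.isZmodMorphism.Build R loc toloc toloc_zmod.
HB.instance Definition _ :=
  GRing.isMonoidMorphism.Build R loc toloc toloc_monoid.

Definition loc_ralgebra : ralgebra R :=
  @RAlgebra R loc toloc (fun r x => mulrC _ _).

End Localization.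

Section BlockPartition.
Variables (R : idomainType) (A : ralgebra R).

(* A^K and A_p, as K (x)_R A and R_p (x)_R A. *)
Definition generic_alg : pzRingType := tensor (frac_ralgebra R) A.

Definition local_alg (p : spec R) : pzRingType := tensor (loc_ralgebra p) A.

Definition local_to_generic (p : spec R) : local_alg p -> generic_alg :=
  @tensor_map R (loc_ralgebra p) (frac_ralgebra R) A A (@loc_val R p) idfun.

Variables (I : choiceType) (c : I -> generic_alg).

(* \sum_(i \in J) is the sum over a set with finite support. It is the intended
   sum when c enumerates the block idempotents of the generic algebra, as there
   are then finitely many indices. *)
Definition Bl (p : spec R) : set (set I) :=
  [set J | exists2 b : local_alg p,
     block_idempotent b & local_to_generic b = \sum_(i \in J) c i].

End BlockPartition.

Definition set_partition (I : Type) (P : set (set I)) : Prop :=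
  partition P id [set: I].

Definition coarser (I : Type) (P' P : set (set I)) : Prop :=
  forall J, P' J -> exists2 Q : set (set I), Q `<=` P & J = \bigcup_(X in Q) X.

Section Strata.
Variables (R : idomainType) (A : ralgebra R).
Variables (I : choiceType) (c : I -> generic_alg A).

Definition Bl_stratum (P : set (set I)) : set (spec R) := [set p | Bl c p = P].

Definition Bl_below (P : set (set I)) : set (spec R) :=
  [set p | coarser (Bl c p) P].

End Strata.

Section Stratification.
Variable X : topologicalType.

Definition relatively_open (S T : set X) : Prop :=
  exists2 U : set X, open U & S = U `&` T.

Definition locally_closed (S : set X) : Prop :=
  exists U C : set X, [/\ open U, closed C & S = U `&` C].

Definition stratification (L : Type) (D : set L) (le : L -> L -> Prop)
    (S : L -> set X) : Prop :=
  [/\ \bigcup_(l in D) S l = setT,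
      trivIset D S,
      forall l, D l -> locally_closed (S l) &
      forall l, D l -> closure (S l) `<=` \bigcup_(k in [set k | D k /\ le k l]) S k].

End Stratification.

(* Main.v *)
Require Import Defs.
From HB Require Import structures.
From mathcomp Require Import all_boot all_order all_algebra.
From mathcomp Require Import finmap mathcomp_extra boolp classical_sets functions.
From mathcomp Require Import cardinality fsbigop topology.
From mathcomp Require Import fraction.

(* Write c_J for the sum of the blocks c_i with i in J. The central idempotents
   of A^K are the c_J, and A_p embeds in A^K by flatness, so the sets J with c_J
   in A_p form a Boolean algebra B_p of subsets of I whose atoms are the members
   of Bl_A(p). Hence Bl_A(p) <= P iff no c_J with J not a union of members of P
   lies in A_p, and Bl_A(p) = P iff moreover c_J lies in A_p for the finitely
   many J in P. For a fixed x in A^K the set of p with x in A_p is open: the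
   denominators of x at p remain invertible near p. *)

Set Implicit Arguments.
Unset Strict Implicit.
Unset Printing Implicit Defensive.

Import GRing.Theory.
Local Open Scope ring_scope.
Local Open Scope classical_set_scope.

(** * Boolean algebras of subsets of a finite set, and their atoms *)

Lemma finite_powerset (T : choiceType) :
  finite_set [set: T] -> finite_set [set: set T].
Proof.
move=> fT.
have -> : [set: set T] =
    (fun X : {fset T} => [set` X]) @` [set` fpowerset (fset_set [set: T])].
  apply/seteqP; split=> // J _; have fJ : finite_set J by exact: sub_finite_set fT.
  exists (fset_set J); last exact: fset_setK.
  by rewrite /= fpowersetE; apply/fsubsetP => x _; rewrite in_fset_set // inE.
exact/finite_image/finite_fset.
Qed.

Section SetAlgebra.
Variables (I : choiceType) (B : set (set I)).

Definition atoms : set (set I) :=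
  [set J | [/\ B J, J !=set0 &
     forall J', B J' -> J' `<=` J -> J' !=set0 -> J' = J]].

Hypotheses (I_fin : finite_set [set: I]) (BT : B setT).
Hypotheses (BC : forall J, B J -> B (~` J)) (BI : setI_closed B).

(** Induction on the size of [J]. If no member of [B] containing [i] cuts [J] down, then [J] is an
    atom: a nonempty [J'] inside [J] that misses [i] would have a complement containing [i], hence
    all of [J]. Otherwise some [J'] gives the smaller member [J] ∩ [J']. *)
Lemma atom_below J i : B J -> J i -> exists X, [/\ atoms X, X i & X `<=` J].
Proof.
have fin (X : set I) : finite_set X by exact: sub_finite_set I_fin.
have [n] := ubnP #|` fset_set J|; elim: n J => // n IHn J ltJ BJ Ji.
have [Jmin|] := pselect (forall J', B J' -> J' i -> J `<=` J').
  exists J; split=> //; split=> //; first by exists i.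
  move=> J' BJ' J'J [j J'j]; apply/seteqP; split=> //.
  have [J'i|J'i] := pselect (J' i); first exact: Jmin.
  by have := Jmin _ (BC BJ') J'i j (J'J _ J'j).
move=> /existsNP[J' /not_implyP[BJ' /not_implyP[J'i /existsNP[j]]]].
move=> /not_implyP[Jj J'j].
have [|||X [aX Xi XJ]] := IHn (J `&` J'); [|exact: BI|by []|].
  rewrite -ltnS (leq_trans _ ltJ) // ltnS; apply: fproper_ltn_card.
  rewrite fproperE; apply/andP; split; first by rewrite -fset_set_sub // => k [].
  by apply/negP; rewrite -fset_set_sub // => /(_ _ Jj)[].
by exists X; split=> // k /XJ[].
Qed.

Lemma atoms_partition : set_partition atoms.
Proof.
split=> [|X Y [BX X0 Xmin] [BY Y0 Ymin] [i [Xi Yi]]|X []//].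
  apply/seteqP; split=> // i _.
  by have [X [aX Xi _]] := atom_below BT (J := setT) (i := i) Logic.I; exists X.
have XY0 : X `&` Y !=set0 by exists i.
rewrite -(Xmin _ (BI BX BY) _ XY0); last by move=> ? [].
by rewrite (Ymin _ (BI BX BY) _ XY0) // => ? [].
Qed.

(** The condition that [coarser] puts on each member, so that [coarser P' P] unfolds to an inclusion
    of [P'] in [set_unions P]. *)
Definition set_unions (P : set (set I)) : set (set I) :=
  [set J | exists2 Q : set (set I), Q `<=` P & J = \bigcup_(X in Q) X].

(** Every member of [B] is a union of atoms. Trading atoms for all of [B] turns the left side into a
    condition that only excludes certain sets from [B]. *)
Lemma coarser_atoms P : coarser atoms P <-> B `<=` set_unions P.
Proof.
split=> [cP J BJ|BP J [BJ _ _]]; last exact: BP.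
exists [set X | P X /\ X `<=` J]; first by move=> X [].
apply/seteqP; split=> [i Ji|i [X [_ XJ] Xi]]; last exact: XJ.
have [Y [aY Yi YJ]] := atom_below BJ Ji.
have [Q QP defY] := cP _ aY; move: (Yi); rewrite defY => -[X QX Xi].
exists X => //; split; first exact: QP.
by apply: subset_trans YJ; rewrite defY => k Xk; exists X.
Qed.

(** When [P] lies in [B] and every member of [B] is a union of members of [P], an atom contains a
    member of [P] and equals it by minimality. Conversely, a nonempty member of [B] inside some [J]
    in [P] contains a member of [P] meeting [J], which is [J] itself. *)
Lemma atoms_eq P : set_partition P ->
  atoms = P <-> coarser atoms P /\ P `<=` B.
Proof.
move=> [covP trivP P0]; split=> [<-|[cP PB]].
  split=> [J aJ|J []//]; exists [set J]; first by move=> _ ->.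
  by rewrite bigcup_set1.
have BP := (coarser_atoms P).1 cP.
apply/seteqP; split=> J.
  move=> [BJ [i Ji] Jmin]; have [Q QP defJ] := BP _ BJ.
  move: (Ji); rewrite defJ => -[X QX Xi].
  rewrite -defJ -(Jmin X) //; [exact: QP|exact/PB/QP| |by exists i].
  by rewrite defJ => k Xk; exists X.
move=> PJ; split=> [||J' BJ' J'J [i J'i]]; [exact: PB|exact: P0|].
apply/seteqP; split=> //; have [Q QP defJ'] := BP _ BJ'.
move: (J'i); rewrite defJ' => -[X QX Xi].
rewrite (trivP J X) //; [by move=> k Xk; exists X|exact: QP|].
by exists i; split=> //; exact: J'J.
Qed.

End SetAlgebra.

(** * Orthogonal central idempotents and their splitting into blocks *)

Section CentralIdempotents.
Variable B : pzRingType.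
Implicit Types (e f g : B) (s : seq B).

(** [pairwise] gives products in list order only; centrality supplies the reversed ones. Excluding 0
    forces the entries to be distinct. *)
Definition orthogonal_idempotents s : Prop :=
  [/\ forall x, x \in s -> central_idempotent x, 0 \notin s &
      pairwise (fun x y => x * y == 0) s].

Lemma orthogonal_idempotents_cons e s : orthogonal_idempotents (e :: s) <->
  [/\ central_idempotent e, e != 0, forall x, x \in s -> e * x = 0 &
      orthogonal_idempotents s].
Proof.
rewrite /orthogonal_idempotents /= inE negb_or eq_sym; split.
  move=> [cs /andP[e0 s0] /andP[/allP es ps]]; split=> //.
    by apply: cs; rewrite inE eqxx.
    by move=> x /es/eqP.
  by split=> // x xs; apply: cs; rewrite inE xs orbT.
move=> [ce e0 es [cs s0 ps]]; split; [|by rewrite e0|].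
  by move=> x; rewrite inE => /predU1P[->|/cs].
by rewrite ps andbT; apply/allP => x /es ->.
Qed.

Lemma orthogonal_idempotents_cat s t :
  orthogonal_idempotents s -> orthogonal_idempotents t ->
  (forall x y, x \in s -> y \in t -> x * y = 0) ->
  orthogonal_idempotents (s ++ t).
Proof.
elim: s => // x s IHs /orthogonal_idempotents_cons[cx x0 xs os] ot st.
apply/orthogonal_idempotents_cons; split=> //.
  by move=> y; rewrite mem_cat => /orP[/xs//|]; apply: st; rewrite inE eqxx.
by apply: IHs => // y z ys zt; apply: st; rewrite // inE ys orbT.
Qed.

Lemma orthogonal_idempotents_sum s x : orthogonal_idempotents s -> x \in s ->
  (\sum_(y <- s) y) * x = x.
Proof.
elim: s => // y s IHs /orthogonal_idempotents_cons[[cy idy] _ ys os].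
rewrite inE big_cons mulrDl => /predU1P[->|xs]; last by rewrite ys // add0r IHs.
rewrite idy mulr_suml big1_seq ?addr0 // => z /andP[_ zs].
by rewrite -cy ys.
Qed.

(* If [e] is not a block it splits as [f + g], and families for [f] and [g]
   are shorter by one, because a family for [f] extends by [g] to one for [e]. *)
Lemma block_decomposition n e :
  central_idempotent e ->
  (forall s, orthogonal_idempotents s -> \sum_(x <- s) x = e -> (size s <= n)%N) ->
  exists s, [/\ orthogonal_idempotents s, \sum_(x <- s) x = e &
                forall x, x \in s -> block_idempotent x].
Proof.
elim: n e => [|n IHn] e ce bnd; have [->|e0] := eqVneq e 0.
- by exists [::]; rewrite big_nil.
- have /bnd : orthogonal_idempotents [:: e].
    by apply/orthogonal_idempotents_cons.
  by rewrite big_seq1 => /(_ erefl).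
- by exists [::]; rewrite big_nil.
have [be|] := pselect (block_idempotent e).
  exists [:: e]; rewrite big_seq1; split=> //.
    by apply/orthogonal_idempotents_cons.
  by move=> x; rewrite inE => /eqP ->.
move=> nbe; have {nbe} : ~ (forall f g, central_idempotent f ->
    central_idempotent g -> f * g = 0 -> e = f + g -> f = 0 \/ g = 0).
  by move=> ?; apply: nbe.
move=> /existsNP[f /existsNP[g /not_implyP[cf /not_implyP[cg]]]].
move=> /not_implyP[fg0 /not_implyP[efg /not_orP[/eqP f0 /eqP g0]]].
have gf0 : g * f = 0 by rewrite cg.1.
have bound f' g' : central_idempotent f' -> central_idempotent g' -> g' != 0 ->
    g' * f' = 0 -> e = g' + f' -> forall s, orthogonal_idempotents s ->
    \sum_(x <- s) x = f' -> (size s <= n)%N.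
  move=> cf' cg' g'0 gf' efg' s os sumf.
  have := bnd (g' :: s); rewrite big_cons sumf -efg' ltnS; apply=> //.
  apply/orthogonal_idempotents_cons; split=> // x xs.
  by rewrite -(orthogonal_idempotents_sum os xs) sumf mulrA gf' mul0r.
have [|s [os sumf bs]] := IHn f cf; first by apply: (bound f g); rewrite // addrC.
have [|t [ot sumg bt]] := IHn g cg; first exact: (bound g f).
exists (s ++ t); rewrite big_cat /= sumf sumg efg; split=> //.
  apply: orthogonal_idempotents_cat => // x y xs yt.
  have [[cx _] _ _] := bs _ xs.
  (* With x = x f and y = g y, the product x y becomes x (f g) y = 0. *)
  have -> : x = x * f by rewrite cx -sumf orthogonal_idempotents_sum.
  have -> : y = g * y by rewrite -sumg orthogonal_idempotents_sum.
  by rewrite mulrA -(mulrA x) fg0 mulr0 mul0r.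
by move=> x; rewrite mem_cat => /orP[/bs|/bt].
Qed.

(** The elements e b and b - e b are orthogonal central idempotents with sum b, so primitivity of b
    kills one of them. *)
Lemma block_mul_central e b : central_idempotent e -> block_idempotent b ->
  e * b = 0 \/ e * b = b.
Proof.
move=> [ce ide] [[cb idb] _ minb].
have ceb : center (e * b) by move=> x; rewrite -mulrA cb !mulrA ce.
have ideb : e * b * (e * b) = e * b.
  by rewrite -mulrA (mulrA b) -ce -mulrA idb mulrA ide.
have [] := minb (e * b) (b - e * b).
- by [].
- split; first by move=> x; rewrite mulrBl mulrBr cb ceb.
  have ebb : e * b * b = e * b by rewrite -mulrA idb.
  by rewrite mulrBr !mulrBl ideb idb ebb cb ebb subrr subr0.
- by rewrite mulrBr ideb -mulrA idb subrr.
- by rewrite addrC subrK.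
- by left.
- by move=> /eqP; rewrite subr_eq0 => /eqP <-; right.
Qed.

End CentralIdempotents.

(** * Sums of blocks when orthogonal families have bounded size, and the blocks of a subring *)

Section GenericBlocks.
Variables (B : pzRingType) (n : nat).
Hypothesis bound : forall s : seq B, orthogonal_idempotents s -> (size s <= n)%N.
Variables (I : choiceType) (c : I -> B).
Hypotheses (c_inj : injective c).
Hypothesis c_blocks : range c = [set e | block_idempotent e].

Let c_block i : block_idempotent (c i).
Proof. by have : range c (c i) by []; rewrite c_blocks. Qed.

Lemma block_orthogonal i j : c i * c j = if i == j then c i else 0.
Proof.
have [<-|ij] := eqVneq i j; first by have [[]] := c_block i.
have [ci _ _] := c_block i; have [cj _ _] := c_block j.
have [//|cij] := block_mul_central ci (c_block j).
have [|] := block_mul_central cj (c_block i); rewrite cj.1 ?cij //.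
by move=> cji; case/eqP: ij; apply: c_inj; rewrite -cji.
Qed.

(** Decompose 1 into blocks. A block f outside the list would be killed by every entry x, since x f
    = f and f x = x give f = x; then f = 1 f = 0. *)
Lemma exists_block_basis : exists s : seq B,
  [/\ uniq s, [set` s] = range c & \sum_(x <- s) x = 1].
Proof.
have c1 : central_idempotent (1 : B) by split=> [x|]; rewrite ?mulr1 ?mul1r.
have [s [os sum1 bs]] := block_decomposition c1 (fun s os _ => bound os).
exists s; split=> //.
- elim: s os {sum1 bs} => //= x s IHs /orthogonal_idempotents_cons[[_ idx] x0 xs os].
  rewrite IHs // andbT; apply: contra_neqN x0 => /xs.
  by rewrite idx.
- rewrite c_blocks; apply/seteqP; split=> [x /bs//|f bf /=].
  have [cf f0 _] := bf; apply: contraT => fs; case/negP: f0.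
  rewrite -[f]mul1r -sum1 mulr_suml big1_seq // => x /andP[_ xs].
  have bx := bs _ xs; have [cx _ _] := bx.
  have [//|xf] := block_mul_central cx bf.
  have [|fx] := block_mul_central cf bx; first by rewrite cf.1.
  by rewrite -xf cx.1 fx xs in fs.
Qed.

Lemma finite_blocks : finite_set [set: I].
Proof.
have [s [_ defs _]] := exists_block_basis.
have : finite_set (range c) by rewrite -defs; exact: finite_seq.
by rewrite (eq_finite_set (inj_card_eq (in2W c_inj))).
Qed.

Let bsum (J : set I) : B := \sum_(i \in J) c i.

Lemma bsum_mul J i : bsum J * c i = if i \in J then c i else 0.
Proof.
have fJ : finite_set J by exact: sub_finite_set finite_blocks.
rewrite /bsum fsbig_finite // mulr_suml -in_fset_set //.
case: ifPn => [iJ|iJ]; last first.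
  rewrite big1_seq // => j /andP[_ jJ]; rewrite block_orthogonal.
  by case: eqP iJ => // <-; rewrite jJ.
rewrite (bigD1_seq i) //= big1 ?addr0 ?block_orthogonal ?eqxx // => j ij.
by rewrite block_orthogonal (negPf ij).
Qed.

Lemma bsumT : bsum setT = 1.
Proof.
have [s [us defs <-]] := exists_block_basis.
rewrite fsbig_seq // defs fsbig_image //; exact: in2W.
Qed.

(** The blocks sum to 1, so x is the sum of its components x c_i. Identities between block sums are
    thereby checked one block at a time. *)
Lemma eq_on_blocks x y : (forall i, x * c i = y * c i) -> x = y.
Proof.
move=> xy; rewrite -[x]mulr1 -[y]mulr1 -bsumT /bsum fsbig_finite.
  by rewrite !mulr_sumr; apply: eq_bigr.
exact: finite_blocks.
Qed.

Lemma bsum0 : bsum set0 = 0.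
Proof. exact: fsbig_set0. Qed.

Lemma bsumC J : bsum (~` J) = 1 - bsum J.
Proof.
apply: eq_on_blocks => i; rewrite mulrBl mul1r !bsum_mul in_setC.
by case: (i \in J); rewrite ?subrr ?subr0.
Qed.

Lemma bsumI J J' : bsum (J `&` J') = bsum J * bsum J'.
Proof.
apply: eq_on_blocks => i; rewrite -mulrA !bsum_mul in_setI [in RHS]fun_if.
by rewrite mulr0 bsum_mul; do 2 case: (_ \in _).
Qed.

Lemma bsum_inj : injective bsum.
Proof.
suff sub J J' : bsum J = bsum J' -> J `<=` J'.
  by move=> J J' JJ'; apply/seteqP; split; exact: sub.
move=> /(congr1 ( *%R^~ (c _))) JJ' i Ji; apply/asboolP.
have := JJ' i; rewrite !bsum_mul (mem_set Ji); case: ifPn => [/set_mem/asboolP//|_].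
by have [_ /eqP] := c_block i.
Qed.

Lemma bsum_central J : central_idempotent (bsum J).
Proof.
split; last by rewrite -bsumI setIid.
have fJ : finite_set J by exact: sub_finite_set finite_blocks.
move=> x; rewrite /bsum fsbig_finite // mulr_suml mulr_sumr.
by apply: eq_bigr => i _; have [[ci _] _ _] := c_block i.
Qed.

(** Each e c_i is 0 or c_i by [block_mul_central]; [J] collects the indices of the second kind. *)
Lemma central_idempotent_bsum e : central_idempotent e -> exists J, e = bsum J.
Proof.
move=> ce; exists [set i | e * c i != 0]; apply: eq_on_blocks => i.
rewrite bsum_mul; case: ifPn => [/set_mem/=|]; last first.
  by rewrite notin_setE /= => /negP; rewrite negbK => /eqP.
by have [->|->//] := block_mul_central ce (c_block i); rewrite eqxx.
Qed.

Variables (L : pzRingType) (iota : {rmorphism L -> B}).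
Hypotheses (iota_inj : injective iota).
Hypothesis iota_center : forall x, center x -> center (iota x).

(** For [L] = A_p this is the Boolean algebra B_p. *)
Definition image_sums : set (set I) := [set J | exists b, iota b = bsum J].

Lemma image_sumsT : image_sums setT.
Proof. by exists 1; rewrite rmorph1 bsumT. Qed.

Lemma image_sumsC J : image_sums J -> image_sums (~` J).
Proof. by move=> [b bJ]; exists (1 - b); rewrite rmorphB rmorph1 bJ bsumC. Qed.

Lemma image_sumsI : setI_closed image_sums.
Proof.
by move=> J J' [b bJ] [b' bJ']; exists (b * b'); rewrite rmorphM bJ bJ' bsumI.
Qed.

Let reflect_central b J : iota b = bsum J -> central_idempotent b.
Proof.
have [cJ idJ] := bsum_central J => bJ; split=> [x|]; apply: iota_inj.
  by rewrite !rmorphM bJ cJ.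
by rewrite rmorphM bJ idJ.
Qed.

(** Via [iota], central idempotents of [L] correspond to members of [image_sums], and products to
    intersections. A smaller member [J'] of the algebra splits b as b' + (b - b'); conversely, in a
    splitting b = f + g the set [K] of f lies in [J], so it is empty or all of [J]. *)
Lemma image_blocks : [set J | exists2 b, block_idempotent b & iota b = bsum J] =
  atoms image_sums.
Proof.
apply/seteqP; split=> J.
  move=> [b [[cb idb] b0 minb] bJ]; split; first by exists b.
    apply/set0P; apply: contra_neq b0 => J0.
    by apply: iota_inj; rewrite bJ J0 bsum0 rmorph0.
  move=> J' [b' bJ'] J'J /set0P J'0; have [cb' idb'] := reflect_central bJ'.
  have b'b : b' * b = b'.
    by apply: iota_inj; rewrite rmorphM bJ bJ' -bsumI setIidl.
  have [] := minb b' (b - b').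
  - by [].
  - split=> [x|]; first by rewrite mulrBl mulrBr cb cb'.
    by rewrite mulrBr !mulrBl idb idb' cb b'b subrr subr0.
  - by rewrite mulrBr b'b idb' subrr.
  - by rewrite addrC subrK.
  - move=> b'0; case/eqP: J'0; apply: bsum_inj.
    by rewrite -bJ' b'0 rmorph0 bsum0.
  - move=> /eqP; rewrite subr_eq0 => /eqP bb'; apply: bsum_inj.
    by rewrite -bJ -bJ' bb'.
move=> [[b bJ] /set0P J0 Jmin]; exists b => //; split=> [||f g cf cg fg0 bfg].
- exact: reflect_central bJ.
- apply: contra_neq J0 => b0; apply: bsum_inj.
  by rewrite -bJ b0 rmorph0 bsum0.
(* [iota_center] is essential here: f is central only in [L], while [K] exists once its image is
   central in [B]. *)
have [|K fK] := @central_idempotent_bsum (iota f).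
  by split; [exact/iota_center/cf.1|rewrite -rmorphM cf.2].
have KJ : K `<=` J.
  apply/setIidPl; apply: bsum_inj; rewrite bsumI -fK -bJ -rmorphM bfg.
  by rewrite mulrDr cf.2 fg0 addr0.
have [K0|K0] := eqVneq K set0.
  by left; apply: iota_inj; rewrite fK K0 bsum0 rmorph0.
right; have fb : f = b.
  apply: iota_inj; rewrite fK bJ; congr bsum; apply: Jmin => //.
    by exists f.
  exact/set0P.
by apply: (addrI f); rewrite -bfg fb addr0.
Qed.

End GenericBlocks.

(** * The generic algebra A^K over K and its subrings A_p *)

Section TensorAlgebras.
Variables (R : idomainType) (A : ralgebra R).
Local Notation K := {fraction R}.
Local Notation AK := (generic_alg A).

(** Multiplication by this element is the K-scalar action on A^K. *)
Definition frac_scalar (k : K) : AK := @tens R (frac_ralgebra R) A k 1.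

Lemma mul_tens (b b' : frac_ralgebra R) (a a' : A) :
  (tens b a : AK) * (tens b' a' : AK) = tens (b * b') (a * a').
Proof. exact: tensor_mul_tens. Qed.

Lemma frac_scalarM k l : frac_scalar (k * l) = frac_scalar k * frac_scalar l.
Proof. by rewrite mul_tens mulr1. Qed.

Lemma frac_scalar1 : frac_scalar 1 = 1.
Proof. by []. Qed.

Lemma frac_scalar_center k : center (frac_scalar k).
Proof.
move=> x; elim/tensor_ind: x => [|x y IHx IHy|l a]; first by rewrite mulr0 mul0r.
  by rewrite mulrDr mulrDl IHx IHy.
by rewrite !mul_tens mul1r mulr1 mulrC.
Qed.

(* Orthogonal nonzero idempotents of the finite-dimensional [K]-algebra are
   linearly independent: a relation is multiplied by each of them in turn. *)
Lemma generic_idempotents_bounded : finitely_presented A ->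
  exists n, forall s : seq AK, orthogonal_idempotents s -> (size s <= n)%N.
Proof.
move=> [_ [n [_ [f [f_surj _]]]]]; exists n => s [cs s0 ps].
rewrite leqNgt; apply/negP => ltns.
(* The n generators of [A] over [R] induce a K-linear surjection from K^n onto A^K. *)
pose phi (v : 'rV[K]_n) : AK :=
  \sum_j @tens R (frac_ralgebra R) A (v 0 j) (f (delta_mx 0 j)).
have phi_surj x : exists v, phi v = x.
  elim/tensor_ind: x => [|x y [v <-] [w <-]|k a].
  - exists 0; rewrite /phi big1 // => j _; rewrite mxE.
    by apply: (addrI (tens 0 (f (delta_mx 0 j)))); rewrite -tensDl !addr0.
  - exists (v + w); rewrite /phi -big_split; apply: eq_bigr => j _.
    by rewrite mxE tensDl.
  - have [v <-] := f_surj a; exists (\row_j (k * FracField.tofrac (v 0 j))).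
    rewrite [in RHS](row_sum_delta v) linear_sum /=.
    have tens0 : @tens R (frac_ralgebra R) A k 0 = 0.
      by apply: (addrI (tens k 0)); rewrite -tensDr !addr0.
    rewrite (big_morph _ (tensDr k) tens0); apply: eq_bigr => j _.
    by rewrite mxE linearZ -tensZ mulrC.
have phiM k v : phi (k *: v) = frac_scalar k * phi v.
  rewrite /phi mulr_sumr; apply: eq_bigr => j _.
  by rewrite mul_tens mul1r mxE.
have phiD : {morph phi : u v / u + v}.
  by move=> u v; rewrite /phi -big_split; apply: eq_bigr => j _; rewrite mxE tensDl.
have phi0 : phi 0 = 0 by apply: (addrI (phi 0)); rewrite -phiD !addr0.
have [V phiV] := choice phi_surj.
(* The rows are preimages of the entries of [s]. With more rows than columns the left kernel is
   nonzero, which yields a nontrivial relation [u]. *)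
pose M := \matrix_(i < size s) V s`_i.
have : kermx M != 0.
  by rewrite kermx_eq0 -row_leq_rank -ltnNge (leq_ltn_trans (rank_leq_col M)).
move=> /rowV0Pn[u /sub_kermxP uM /rV0Pn[i ui]].
have : phi (u *m M) = 0 by rewrite uM.
have mems (j : 'I_(size s)) : s`_j \in s by rewrite mem_nth.
have -> : phi (u *m M) = \sum_j frac_scalar (u 0 j) * s`_j.
  rewrite mulmx_sum_row (big_morph phi phiD phi0); apply: eq_bigr => j _.
  by rewrite phiM rowK phiV.
move=> /(congr1 ( *%R^~ s`_i)); rewrite mul0r mulr_suml (bigD1 i) //=.
rewrite big1 ?addr0 => [|j ji]; last first.
  rewrite -mulrA; suff -> : s`_j * s`_i = 0 by rewrite mulr0.
  have [lt|lt|/val_inj eqji] := ltngtP j i; last by rewrite eqji eqxx in ji.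
    by apply/eqP/(pairwiseP 0 ps); rewrite ?inE.
  by rewrite (cs _ (mems j)).1; apply/eqP/(pairwiseP 0 ps); rewrite ?inE.
rewrite -mulrA (cs _ (mems i)).2 => /(congr1 ( *%R (frac_scalar (u 0 i)^-1))).
rewrite mulrA -frac_scalarM mulVf // frac_scalar1 mul1r mulr0 => si0.
by case/negP: s0; rewrite -si0.
Qed.

(** [loc_val] retyped as a map of R-modules, the form to which [flat] applies. *)
Definition loc_inclusion (p : spec R) (x : loc_ralgebra p) : frac_ralgebra R :=
  loc_val x.

Lemma loc_inclusion_linear (p : spec R) : linear (@loc_inclusion p).
Proof. by []. Qed.

HB.instance Definition _ (p : spec R) := GRing.isLinear.Build R
  (loc_ralgebra p) (frac_ralgebra R) *:%R (@loc_inclusion p)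
  (@loc_inclusion_linear p).

(** * The embedding of A_p in A^K *)

Section LocalToGeneric.
Variable p : spec R.
Local Notation Ap := (local_alg A p).
Local Notation iota := (@local_to_generic R A p).

Lemma local_to_generic_balanced : balanced (fun (m : loc_ralgebra p) (a : A) =>
  @tens R (frac_ralgebra R) A (loc_val m) a).
Proof.
by split=> [m m' a|m a a'|r m a]; rewrite -?tensDl -?tensDr -?tensZ.
Qed.

Lemma local_to_generic_tens (m : loc_ralgebra p) (a : A) :
  iota (tens m a) = @tens R (frac_ralgebra R) A (loc_val m) a.
Proof. exact: (tensor_lift_tens local_to_generic_balanced). Qed.

Lemma local_to_generic_nmod : nmod_morphism iota.
Proof.
split; first exact: (tensor_lift0 local_to_generic_balanced).
exact: (tensor_liftD local_to_generic_balanced).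
Qed.

HB.instance Definition _ :=
  GRing.isNmodMorphism.Build Ap AK iota local_to_generic_nmod.

Lemma local_to_generic_monoid : monoid_morphism iota.
Proof.
split=> [|x y]; first by rewrite local_to_generic_tens.
elim/tensor_ind: x => [|x x' IHx IHx'|b a]; first by rewrite mul0r raddf0 mul0r.
  by rewrite mulrDl !raddfD /= IHx IHx' mulrDl.
elim/tensor_ind: y => [|y y' IHy IHy'|b' a']; first by rewrite mulr0 raddf0 mulr0.
  by rewrite mulrDr !raddfD /= IHy IHy' mulrDr.
rewrite !local_to_generic_tens mul_tens -[_ * _ in LHS]/(tensor_mul _ _).
by rewrite tensor_mul_tens local_to_generic_tens.
Qed.

HB.instance Definition _ :=
  GRing.isMonoidMorphism.Build Ap AK iota local_to_generic_monoid.

Lemma local_to_generic_inj : flat A -> injective iota.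
Proof.
by move=> A_flat; apply: (A_flat _ _ (@loc_inclusion p)); exact: val_inj.
Qed.

(** A^K is generated by central scalars and the image of A_p, because k ⊗ a = (k ⊗ 1) [iota] (1 ⊗
    a). *)
Lemma local_to_generic_center x : center x -> center (iota x).
Proof.
move=> cx y; elim/tensor_ind: y => [|y z IHy IHz|k a]; first by rewrite mulr0 mul0r.
  by rewrite mulrDr mulrDl IHy IHz.
have -> : tens k a = frac_scalar k * iota (@tens R (loc_ralgebra p) A 1 a).
  by rewrite local_to_generic_tens mul_tens mulr1 mul1r.
by rewrite mulrA -frac_scalar_center -mulrA -rmorphM cx rmorphM mulrA.
Qed.

End LocalToGeneric.

(** A pure tensor (r / s) ⊗ a makes sense at every prime avoiding s; for a sum, the product of the
    two denominators works. *)
Lemma local_to_generic_denominator (p : spec R) (x : local_alg A p) :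
  exists2 s, s \notin spec_ideal p &
  forall q : spec R, s \notin spec_ideal q ->
  exists y, @local_to_generic R A q y = local_to_generic x.
Proof.
have [p0 p1 _] := spec_idealP p.
elim/tensor_ind: x => [|x y [s ps xs] [t pt yt]|[k kp] a].
- exists 1; first exact: p1.
  by move=> q _; exists 0; rewrite !raddf0.
- exists (s * t).
    by apply/negP => /spec_primeP; rewrite (negPf ps) (negPf pt).
  move=> q qst; have [_ _ qD] := spec_idealP q.
  have qM r z : z \in spec_ideal q -> r * z \in spec_ideal q.
    by move=> qz; have := qD r z 0 qz; rewrite addr0; apply; have [] := spec_idealP q.
  have [|x' xx'] := xs q; first by apply: contra qst => ?; rewrite mulrC qM.
  have [|y' yy'] := yt q; first by apply: contra qst => ?; rewrite qM.
  by exists (x' + y'); rewrite !raddfD /= xx' yy'.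
have /asboolP[r [s [ps defk]]] := kp; exists s => // q qs.
have kq : k \in loc_pred q by apply/asboolP; exists r, s.
by exists (@tens R (loc_ralgebra q) A (Loc kq) a); rewrite !local_to_generic_tens.
Qed.

Lemma open_defined (x : AK) :
  open [set p : spec R | exists b, @local_to_generic R A p b = x].
Proof.
rewrite openE => p [b <-]; have [s ps sP] := local_to_generic_denominator b.
(* The basic open set D(s) of a common denominator is the required neighbourhood. *)
rewrite /interior nbhsE /=; exists (~` zariski_closed [set s]); last first.
  move=> q /= /existsNP[_ /not_implyP[-> /negP]]; exact: sP.
split; first by exists [set s].
by move=> /(_ _ erefl); apply/negP.
Qed.

End TensorAlgebras.

Theorem theorem1p2 (R : idomainType) (A : ralgebra R)
    (A_fp : finitely_presented A) (A_flat : flat A)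
    (I : choiceType) (c : I -> generic_alg A) (c_inj : injective c)
    (c_blocks : range c = [set e | block_idempotent e]) :
  (forall P : set (set I), set_partition P ->
     [/\ closed (Bl_below c P),
         relatively_open (Bl_stratum c P) (Bl_below c P),
         locally_closed (Bl_stratum c P) &
         closure (Bl_stratum c P) `<=` Bl_below c P]) /\
  finite_set [set P : set (set I) | set_partition P] /\
  stratification [set P : set (set I) | set_partition P]
    (@coarser I) (Bl_stratum c).
Proof.
have [n bound] := generic_idempotents_bounded A_fp.
have I_fin := finite_blocks bound c_inj c_blocks.
have sets_fin : finite_set [set: set I] by exact: finite_powerset.
pose D p := image_sums c (@local_to_generic R A p).
have DT p : D p setT := image_sumsT bound c_inj c_blocks _.
have DC p J : D p J -> D p (~` J) := @image_sumsC _ _ bound _ _ c_inj c_blocks _ _ J.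
have DI p : setI_closed (D p).
  by move=> J J'; exact: (image_sumsI bound c_inj c_blocks).
(* Flatness enters here, through the injectivity of A_p → A^K. *)
have Bl_atoms p : Bl c p = atoms (D p).
  exact: (image_blocks bound c_inj c_blocks (@local_to_generic_inj R A p A_flat)
    (@local_to_generic_center R A p)).
have Bl_partition p : set_partition (Bl c p).
  by rewrite Bl_atoms; exact: (atoms_partition I_fin (@DT p) (@DC p) (@DI p)).
have D_open J : open [set p | D p J] := open_defined _.
have belowE P p : Bl_below c P p <-> D p `<=` set_unions P.
  by rewrite /Bl_below /= Bl_atoms; exact: (coarser_atoms I_fin (@DC p) (@DI p)).
have below_closed P : closed (Bl_below c P).
  (* The complement is the union, over the forbidden [J], of the open loci where c_J is defined. *)
  have -> : Bl_below c P =
      ~` \bigcup_(J in ~` set_unions P) [set p | D p J].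
    apply/seteqP; split=> p; first by move=> /belowE DP [J PJ /DP].
    by move=> DP; apply/belowE => J DJ; apply: contrapT => PJ; apply: DP; exists J.
  by apply: open_closedC; exact: bigcup_open.
pose U (P : set (set I)) := [set p | P `<=` D p].
have U_open P : open (U P).
  have fP : finite_set P by exact: sub_finite_set sets_fin.
  (* Finiteness of [P] makes [U P] a finite intersection of open loci. *)
  rewrite openE => p PDp; rewrite /interior -(fset_setK fP).
  have -> : U [set` fset_set P] = \bigcap_(J in [set` fset_set P]) [set q | D q J].
    by apply/seteqP; split=> q.
  apply: filter_bigI => J; rewrite in_fset_set // => /set_mem PJ.
  exact: (open_nbhs_nbhs (conj (D_open J) (PDp _ PJ))).
have stratumE P : set_partition P -> Bl_stratum c P = U P `&` Bl_below c P.
  move=> partP; apply/seteqP; split=> p; rewrite /Bl_stratum /Bl_below /= Bl_atoms.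
    by move=> /(atoms_eq I_fin (@DC p) (@DI p) partP)[].
  by move=> [PD cP]; apply/(atoms_eq I_fin (@DC p) (@DI p) partP).
have closure_below P : set_partition P ->
    closure (Bl_stratum c P) `<=` Bl_below c P.
  (* A closed set equals its closure, so monotonicity of closure suffices. *)
  move=> partP; rewrite [X in _ `<=` X](closure_id _).1 //; apply: closureS.
  by rewrite stratumE //; exact: subIsetr.
have loc_closed P : set_partition P -> locally_closed (Bl_stratum c P).
  by move=> partP; exists (U P), (Bl_below c P); split=> //; exact: stratumE.
split=> [P partP|].
  split; [exact: below_closed|by exists (U P) => //; exact: stratumE| |].
    exact: loc_closed.
  exact: closure_below.
(* Partitions are elements of the double power set of the finite [I]. *)
split; first exact: sub_finite_set (finite_powerset sets_fin).
split=> //.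
- by apply/seteqP; split=> // p _; exists (Bl c p); [exact: Bl_partition|].
- by move=> P Q _ _ [p [/= <- <-]].
(* The stratum through [p] is the one indexed by [Bl c p]. *)
- move=> P partP p /(closure_below _ partP) cP.
  by exists (Bl c p) => //; split; [exact: Bl_partition|exact: cP].
Qed.
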